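(* Let $\mathcal{X}$ be a class of graphs. Then the partition complementation number is bounded in $\mathcal{X}$ if and only if $\mathcal{X}$ is a function of the class of equivalence graphs.
   Context: All graphs are finite and simple; a class of graphs is a set of graphs closed under isomorphism. An equivalence graph is a graph each of whose connected components is complete. For a graph $G=(V,E)$ and a partition $(V_1,\dots,V_k)$ of $V$, the partition complementation of $G$ with respect to this partition is the graph obtained from $G$ by complementing the edges within each induced subgraph $G[V_1],\dots,G[V_k]$ (edges between different parts unchanged). The partition complementation number of $G$ is the minimum $k$ such that there is a sequence $G_0,\dots,G_k$ with $G_0=(V,\emptyset)$, $G_k=G$, and each $G_i$ a partition complementation of $G_{i-1}$. It is bounded in $\mathcal{X}$ if some constant bounds it for all graphs in $\mathcal{X}$. For a graph $G$ and distinct vertices $u,w$, $G(u,w)=1$ if they are adjacent and $0$ otherwise. If $G,H_1,\dots,H_k$ are graphs on the same vertex set $V$, $G$ is a (boolean) function of $H_1,\dots,H_k$ if there is a boolean function $f:\{0,1\}^k\to\{0,1\}$ with $G(a,b)=f(H_1(a,b),\dots,H_k(a,b))$ for all distinct $a,b\in V$. A class $\mathcal{Y}$ is a $k$-function of $\mathcal{X}$ if every $G\in\mathcal{Y}$ is a function of at most $k$ graphs from $\mathcal{X}$ (on the vertex set of $G$); $\mathcal{Y}$ is a function of $\mathcal{X}$ if it is a $k$-function for some $k\in\mathbb{N}$. *)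

(* Defs.v *)
From HB Require Import structures.
From mathcomp Require Import all_boot boolp.

Set Implicit Arguments.
Unset Strict Implicit.
Unset Printing Implicit Defensive.

Record graph (V : finType) := Graph {
  adj :> rel V;
  adj_sym : symmetric adj;
  adj_irr : irreflexive adj }.

Lemma graph_eq (V : finType) (G H : graph V) : adj G =2 adj H -> G = H.
Proof.
case: G H => [g gs gi] [h hs hi] /= gh.
have E : g = h by apply/funext => x; apply/funext => y.
by subst h; congr Graph; apply: Prop_irrelevance.
Qed.

Definition isomorphic (V W : finType) (G : graph V) (H : graph W) : Prop :=
  exists2 f : V -> W, bijective f & forall x y, H (f x) (f y) = G x y.

Record graph_class := GraphClass {
  in_class :> forall V : finType, graph V -> Prop;
  class_iso : forall (V W : finType) (G : graph V) (H : graph W),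
    isomorphic G H -> in_class G -> in_class H }.

Definition is_equivalence_graph (V : finType) (G : graph V) : Prop :=
  forall x y : V, connect G x y -> x != y -> G x y.

Lemma is_equivalence_graph_iso (V W : finType) (G : graph V) (H : graph W) :
  isomorphic G H -> is_equivalence_graph G -> is_equivalence_graph H.
Proof.
move=> [f [g fK gK] fE] eqG x y /connectP[p pth ->] {y}.
rewrite -(gK x) -(gK (last _ _)) fE (can_eq fK) => ne; apply: eqG => //.
rewrite gK -last_map; apply/connectP; exists (map g p) => //.
rewrite path_map; apply: sub_path pth => u v /=.
by rewrite -{1}(gK u) -{1}(gK v) fE.
Qed.

Definition equivalence_graphs : graph_class :=
  GraphClass is_equivalence_graph_iso.

Definition edgeless (V : finType) : graph V :=
  @Graph V (fun _ _ => false) (fun _ _ => erefl) (fun _ => erefl).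

Section PartitionComplementation.

Variable V : finType.
Implicit Types (G H : graph V) (P : {set {set V}}).

Definition same_part P (u v : V) : bool :=
  [exists B in P, (u \in B) && (v \in B)].

Definition pc_adj G P : rel V := fun u v =>
  if same_part P u v then (u != v) && ~~ G u v else G u v.

Lemma pc_adj_sym G P : symmetric (pc_adj G P).
Proof.
move=> u v; rewrite /pc_adj adj_sym eq_sym.
suff -> : same_part P u v = same_part P v u by [].
by apply: eq_existsb => B; rewrite [(u \in B) && _]andbC.
Qed.

Lemma pc_adj_irr G P : irreflexive (pc_adj G P).
Proof. by move=> u; rewrite /pc_adj eqxx adj_irr if_same. Qed.

Definition partition_complement G P : graph V :=
  Graph (pc_adj_sym G P) (pc_adj_irr G P).

Definition is_partition_complementation G H : Prop :=
  exists2 P, partition P [set: V] & H = partition_complement G P.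

(* Only the values s 0, ..., s k of the sequence s are constrained. *)
Definition pc_reachable G (k : nat) : Prop :=
  exists s : nat -> graph V,
    [/\ s 0 = edgeless V, s k = G
      & forall i, i < k -> is_partition_complementation (s i) (s i.+1)].

Lemma pc_reachableS G H k :
  pc_reachable G k -> is_partition_complementation G H -> pc_reachable H k.+1.
Proof.
move=> [s [s0 sk sP]] GH; exists (fun i => if i <= k then s i else H).
split=> // [|i]; first by rewrite ltnn.
move=> /ltnSE /=; case: ltngtP => // [ik|->] _; first exact: sP.
by rewrite sk.
Qed.

(* Toggling one edge ab is the partition complementation for {a, b} and
   singletons, so every graph is reachable and the minimum below exists. *)
Lemma pc_reachable_ex G : exists k, pc_reachable G k.
Proof.
pose E (s : seq (V * V)) x y := (x != y) && (((x, y) \in s) || ((y, x) \in s)).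
have Esym s : symmetric (E s) by move=> x y; rewrite /E eq_sym orbC.
have Eirr s : irreflexive (E s) by move=> x; rewrite /E eqxx.
suff reachE s : exists k, pc_reachable (Graph (Esym s) (Eirr s)) k.
  have [k kP] := reachE (enum [pred p | G p.1 p.2]); exists k.
  suff <- : Graph (Esym (enum [pred p | G p.1 p.2])) (Eirr _) = G by [].
  apply: graph_eq => x y /=; rewrite /E !mem_enum !inE /= (adj_sym G y x) orbb.
  by case: eqVneq => [->|//]; rewrite adj_irr.
elim: s => [|[a b] s [k kP]].
  exists 0, (fun=> edgeless V); split=> //.
  by apply: graph_eq => x y /=; rewrite /E andbF.
have [old|new] := boolP ((a == b) || E s a b).
  exists k; suff -> : Graph (Esym ((a, b) :: s)) (Eirr _)
                      = Graph (Esym s) (Eirr s) by [].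
  apply: graph_eq => x y /=; move: old; rewrite /E !inE !xpair_eqE.
  case: (eqVneq x y) => //= xy ab.
  apply/idP/idP; last by case/orP => ->; rewrite ?orbT.
  case/orP => /orP[/andP[/eqP xE /eqP yE]|->]; rewrite ?orbT //; subst;
    move: ab; last rewrite eq_sym; rewrite (negPf xy) //=.
  by rewrite orbC.
exists k.+1; apply: pc_reachableS kP _.
pose f x := if x == b then a else x.
exists (preim_partition f [set: V]); first exact: preim_partitionP.
have spE x y : same_part (preim_partition f [set: V]) x y = (f x == f y).
  have /and3P[/eqP cov tI _] := preim_partitionP f [set: V].
  have eqR : {in [set: V] & &, equivalence_rel (fun x y => f x == f y)}.
    by split=> // /eqP->.
  rewrite -(pblock_equivalence_partition eqR) ?inE //.
  apply/existsP/idP => [[B /and3P[BP xB yB]]|yx].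
    by rewrite (def_pblock tI BP xB).
  exists (pblock (preim_partition f [set: V]) x).
  by rewrite pblock_mem ?mem_pblock ?cov ?inE.
apply: graph_eq => x y /=; rewrite /pc_adj spE /=.
move: new; rewrite negb_or /E /f !inE !xpair_eqE => /andP[ab]; rewrite ab /=.
rewrite negb_or => /andP[/negPf abs /negPf bas].
case: (eqVneq x y) => [->|xy] //=; first by rewrite if_same.
case: (eqVneq x b) => [xb|xb]; case: (eqVneq y b) => [yb|yb] /=; subst;
  rewrite ?eqxx ?(negPf ab) ?[b == a]eq_sym ?(negPf ab) ?(negPf xy)
          ?andbF ?orbF //=.
- by rewrite eqxx in xy.
- by rewrite andbT [a == y]eq_sym; case: (eqVneq y a) => [->|//]; rewrite bas abs.
- by rewrite andbT; case: (eqVneq x a) => [->|//]; rewrite abs bas.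
Qed.

Lemma pc_reachable_exb G : exists k, `[< pc_reachable G k >].
Proof. by have [k kP] := pc_reachable_ex G; exists k; apply/asboolP. Qed.

Definition partition_complementation_number G : nat :=
  ex_minn (pc_reachable_exb G).

End PartitionComplementation.

Definition bounded_pc_number (X : graph_class) : Prop :=
  exists c : nat, forall (V : finType) (G : graph V),
    X V G -> partition_complementation_number G <= c.

Definition boolean_function_of (V : finType) (G : graph V) (m : nat)
    (H : 'I_m -> graph V) : Prop :=
  exists f : m.-tuple bool -> bool,
    forall a b : V, a != b -> G a b = f [tuple H i a b | i < m].

Definition k_function_of (k : nat) (Y X : graph_class) : Prop :=
  forall (V : finType) (G : graph V), Y V G ->
    exists m : nat, m <= k /\
      exists2 H : 'I_m -> graph V, (forall i, X V (H i))
        & boolean_function_of G H.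

Definition function_of (Y X : graph_class) : Prop :=
  exists k : nat, k_function_of k Y X.

(* Main.v *)
From mathcomp Require Import all_boot boolp.
Require Import Defs.

(** A partition complementation adds, modulo 2, the equivalence graph of the
    partition, so a graph obtained in [k] steps is the sum modulo 2 of [k]
    equivalence graphs.  Conversely, a boolean function of [k] graphs is a
    polynomial over F_2 in them; its at most [2 ^ k] monomials are
    intersections of equivalence relations, hence equivalence relations, and
    each one is added by a single partition complementation. *)

Set Implicit Arguments.
Unset Strict Implicit.
Unset Printing Implicit Defensive.

Section Toggling.

Variable V : finType.
Implicit Types (G H : graph V) (e : rel V).

Lemma pc_number_reachable G :
  pc_reachable G (partition_complementation_number G).
Proof. by rewrite /partition_complementation_number; case: ex_minnP => ? /asboolP. Qed.

Lemma pc_number_le G k :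
  pc_reachable G k -> partition_complementation_number G <= k.
Proof.
move=> Gk; rewrite /partition_complementation_number.
by case: ex_minnP => j _; apply; apply/asboolP.
Qed.

Lemma pc_number_edgeless : partition_complementation_number (edgeless V) = 0.
Proof. by apply/eqP; rewrite -leqn0; apply: pc_number_le; exists (fun=> edgeless V). Qed.

Lemma same_partE P : partition P [set: V] ->
  forall x y, same_part P x y = (pblock P x == pblock P y).
Proof.
move=> /and3P[/eqP cov tI _] x y; rewrite eq_pblock ?cov ?inE //.
apply/existsP/idP => [[B /and3P[BP xB yB]]|yx].
  by rewrite (def_pblock tI BP xB).
by exists (pblock P x); rewrite pblock_mem ?mem_pblock ?cov ?inE.
Qed.

Lemma same_part_equivalence e : equivalence_rel e ->
  forall x y, same_part (equivalence_partition e [set: V]) x y = e x y.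
Proof.
move=> eqe x y.
have eqeT : {in [set: V] & &, equivalence_rel e} by move=> ? ? ? _ _ _; apply: eqe.
have eP := equivalence_partitionP eqeT.
have /and3P[/eqP cov tI _] := eP.
by rewrite same_partE // eq_pblock ?cov ?inE // pblock_equivalence_partition ?inE.
Qed.

(** Complementing inside the classes of [e] flips exactly the pairs of distinct vertices related by
    [e], so one extra step leads from [G] to [H]. *)
Lemma pc_number_toggle e G H : equivalence_rel e ->
  (forall x y, x != y -> H x y = G x y (+) e x y) ->
  partition_complementation_number H <= (partition_complementation_number G).+1.
Proof.
move=> eqe HE; apply/pc_number_le/pc_reachableS; first exact: pc_number_reachable.
exists (equivalence_partition e [set: V]).
  by apply: equivalence_partitionP => ? ? ? _ _ _; apply: eqe.
apply: graph_eq => x y /=; rewrite /pc_adj same_part_equivalence //.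
case: (eqVneq x y) => [->|xy]; first by rewrite !adj_irr if_same.
by rewrite HE //=; case: (e x y); rewrite ?addbT ?addbF.
Qed.

Lemma equivalence_rel_and e1 e2 : equivalence_rel e1 -> equivalence_rel e2 ->
  equivalence_rel (fun x y => e1 x y && e2 x y).
Proof.
move=> eq1 eq2 x y z; split=> [|/andP[xy1 xy2]].
  by rewrite (eq1 z z z).1 (eq2 z z z).1.
by rewrite (eq1 x y z).2 // (eq2 x y z).2.
Qed.

Lemma equivalence_rel_sym e : equivalence_rel e -> symmetric e.
Proof. by move=> /equivalence_relP[er et] x y; apply/idP/idP => xy; rewrite -(et _ _ xy). Qed.

(* The restriction to a further relation [e0] makes the induction on [m] work:
   with [f0] and [f1] the two restrictions of [f] in its last variable,
   [e0 && f = (e0 && f0) (+) ((e0 && e_m) && (f0 (+) f1))]. *)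
Lemma pc_number_boolean_toggle m (ee : nat -> rel V) e0 (f : seq bool -> bool) G H :
  (forall i, equivalence_rel (ee i)) -> equivalence_rel e0 ->
  (forall x y, x != y ->
     H x y = G x y (+) (e0 x y && f (mkseq (fun i => ee i x y) m))) ->
  partition_complementation_number H
    <= partition_complementation_number G + 2 ^ m.
Proof.
move=> eqee; elim: m e0 f G H => [|m IHm] e0 f G H eq0 HE.
  (* Without variables [f] is a constant: if true, toggling [e0] is the single step allowed by
     [2 ^ 0]; if false, [H] is [G]. *)
  rewrite addn1; case fnil: (f [::]).
    by apply: (pc_number_toggle eq0) => x y /HE ->; rewrite /= fnil andbT.
  suff -> : H = G by [].
  apply: graph_eq => x y; case: (eqVneq x y) => [->|/HE ->].
    by rewrite !adj_irr.
  by rewrite /= fnil andbF addbF.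
pose f0 s := f (rcons s false); pose f1 s := f (rcons s true).
(* The graph halfway from [G] to [H], with only the [f0] summand added; the factor [x != y] clears
   the diagonal, where [e0] holds. *)
pose r x y := (x != y) && (G x y (+) (e0 x y && f0 (mkseq (fun i => ee i x y) m))).
have r_sym : symmetric r.
  move=> x y; rewrite /r eq_sym adj_sym (equivalence_rel_sym eq0).
  by under eq_mkseq => i do rewrite (equivalence_rel_sym (eqee i)).
have r_irr : irreflexive r by move=> x; rewrite /r eqxx.
have leK : partition_complementation_number (Graph r_sym r_irr)
             <= partition_complementation_number G + 2 ^ m.
  by apply: (IHm e0 f0) => // x y xy; rewrite /= /r xy.
rewrite expnS mul2n -addnn addnA.
apply: leq_trans (leq_add leK (leqnn _)).
apply: (IHm _ (fun s => f0 s (+) f1 s)).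
  exact: equivalence_rel_and eq0 (eqee m).
move=> x y xy; rewrite HE //= /r xy /= mkseqS /f0 /f1 -addbA; congr addb.
by case: (e0 x y); case: (ee m x y); rewrite //= ?addbF // addbA addbb.
Qed.

(** Adjacency is irreflexive, so connectivity stands in for it as a genuine equivalence relation. *)
Lemma connect_equivalence_rel G : equivalence_rel (connect G).
Proof.
apply/equivalence_relP; split; first exact: connect0.
by apply/left_trans; [apply/sym_connect_sym/adj_sym | exact: connect_trans].
Qed.

Lemma equivalence_graphE G : is_equivalence_graph G ->
  forall x y, x != y -> G x y = connect G x y.
Proof. by move=> eqG x y xy; apply/idP/idP => [/connect1|/eqG->]. Qed.

Lemma equivalence_graph_rel e G : equivalence_rel e ->
  (forall x y, G x y = (x != y) && e x y) -> is_equivalence_graph G.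
Proof.
move=> eqe GE x y Gxy xy; rewrite GE xy /=.
have /equivalence_relP[er et] := eqe.
case/connectP: Gxy => p; elim: p x {xy} => [|z p IHp] x /=; first by move=> _ ->.
by rewrite GE => /andP[/andP[_ /et ->]]; apply: IHp.
Qed.

Lemma pc_number_boolean_function m (H : 'I_m -> graph V) G :
  (forall i, is_equivalence_graph (H i)) -> boolean_function_of G H ->
  partition_complementation_number G <= 2 ^ m.
Proof.
move=> eqH [f fE].
(* Indices from [m] on get the full relation, which keeps every [ee i] an equivalence; the default
   of [f'] is never reached, as its argument has length [m]. *)
pose ee i := oapp (fun j => connect (H j)) (fun _ _ => true) (insub i).
pose f' s := oapp f false (insub s).
rewrite -[2 ^ m]add0n -{1}pc_number_edgeless.
apply: (@pc_number_boolean_toggle m ee (fun _ _ => true) f') => //.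
  by move=> i; rewrite /ee; case: insub => //= j; apply: connect_equivalence_rel.
move=> x y xy; rewrite fE //= /f'.
suff -> : mkseq (fun i => ee i x y) m = [tuple H i x y | i < m] by rewrite valK.
rewrite /mkseq -val_enum_ord -map_comp; apply: eq_map => i /=.
by rewrite /ee valK /= equivalence_graphE.
Qed.

Lemma adj_addb_sym G H : symmetric (fun x y => G x y (+) H x y).
Proof. by move=> x y; rewrite adj_sym (adj_sym H). Qed.

Lemma adj_addb_irr G H : irreflexive (fun x y => G x y (+) H x y).
Proof. by move=> x; rewrite !adj_irr. Qed.

Definition sum_graph G H : graph V := Graph (adj_addb_sym G H) (adj_addb_irr G H).

(** The two graphs differ exactly on the pairs of distinct vertices lying in a common block. *)
Lemma sum_graph_partition_complementation G H :
  is_partition_complementation G H -> is_equivalence_graph (sum_graph G H).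
Proof.
move=> [P partP ->].
apply: (@equivalence_graph_rel (fun x y => pblock P x == pblock P y)).
  by move=> x y z; split=> // /eqP->.
move=> x y /=; rewrite /pc_adj same_partE //.
case: (eqVneq x y) => [->|_]; first by rewrite !adj_irr if_same.
by case: ifP => _; rewrite /= ?addbN addbb.
Qed.

Lemma pc_reachable_boolean_function G k : pc_reachable G k ->
  exists2 H : 'I_k -> graph V,
    (forall i, is_equivalence_graph (H i)) & boolean_function_of G H.
Proof.
move=> [s [s0 <- sP]]; exists (fun i => sum_graph (s i) (s i.+1)).
  by move=> i; apply/sum_graph_partition_complementation/sP.
(* Parity is the boolean function: the sum of consecutive differences telescopes from the edgeless
   [s 0] to [s k]. *)
exists (fun t => \big[addb/false]_(i < k) tnth t i) => x y _.
under eq_bigr do rewrite tnth_mktuple.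
elim: k {sP} => [|k IHk]; first by rewrite big_ord0 s0.
by rewrite big_ord_recr /= -IHk addbA addbb.
Qed.

End Toggling.

Theorem theorem4p23 (X : graph_class) :
  bounded_pc_number X <-> function_of X equivalence_graphs.
Proof.
split=> [[c Xc]|[k Xk]].
  exists c => V G /Xc le_c; exists (partition_complementation_number G); split=> //.
  exact: pc_reachable_boolean_function (pc_number_reachable G).
exists (2 ^ k) => V G /Xk[m [le_mk [H eqH GH]]].
exact: leq_trans (pc_number_boolean_function eqH GH) (leq_pexp2l _ le_mk).
Qed.
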